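(* Let $f\in\mathbb{R}[X]$ be a polynomial of degree $d\geq 2$ with real coefficients. The following are equivalent: (1) $\mathrm{J}(f)\subseteq\mathbb{R}$, i.e. the Julia set of $f$ is real. (2) $\mathrm{FJ}(f)\subseteq\mathbb{R}$, i.e. the filled Julia set of $f$ is real. (3) The set of complex preperiodic points satisfies $\mathrm{PrePer}(f,\mathbb{C})\subseteq\mathbb{R}$. (4) The set of real preperiodic points $\mathrm{PrePer}(f,\mathbb{R})$ is nonempty and is contained in the critical interval $\mathrm{I}(f)$.
   Context: $\mathrm{J}(f)\subseteq\mathbb{P}^1(\mathbb{C})$ is the Julia set of $f$, i.e. the complement of the maximal open subset of $\mathbb{P}^1(\mathbb{C})$ on which the family of iterates of $f$ is equicontinuous. The filled Julia set $\mathrm{FJ}(f)$ is the set of $z\in\mathbb{C}$ such that $f^n(z)$ is bounded as $n\to\infty$. For $R=\mathbb{R}$ or $\mathbb{C}$, $\mathrm{PrePer}(f,R)$ is the set of points of $R$ with finite forward orbit under $f$. The critical interval $\mathrm{I}(f)$ is the set of all $t\in\mathbb{R}$ such that $f(X)=t$ has $d$ real solutions counted with multiplicity. *)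

(* Defs.v *)
From HB Require Import structures.
From mathcomp Require Import all_boot all_order all_algebra.
From mathcomp Require Import all_classical all_reals all_analysis.
From mathcomp Require Import complex ring.

Set Implicit Arguments.
Unset Strict Implicit.
Unset Printing Implicit Defensive.

Import Order.TTheory GRing.Theory Num.Theory.
Import numFieldNormedType.Exports Normc.

Local Open Scope classical_set_scope.
Local Open Scope complex_scope.
Local Open Scope ring_scope.

(* The projective line over the complex numbers, as the Riemann sphere:
   [Some z] is the point [z : 1], [None] is the point at infinity [1 : 0]. *)
Definition P1 (R : Type) : Type := option R[i].

Section ChordalMetric.
Variable R : realType.
Implicit Types (a b c : R[i] * R[i]) (x y z : P1 R).

Definition P1_coord x : R[i] * R[i] := if x is Some z then (z, 1) else (1, 0).

Definition P1_wedge a b : R[i] := a.1 * b.2 - a.2 * b.1.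

Definition P1_norm a : R := Num.sqrt (normc a.1 ^+ 2 + normc a.2 ^+ 2).

(* For finite points this is |z - w| / (sqrt(1 + |z|^2) * sqrt(1 + |w|^2)),
   and 1 / sqrt(1 + |z|^2) between z and infinity. *)
Definition chordal x y : R :=
  let a := P1_coord x in let b := P1_coord y in
  normc (P1_wedge a b) / (P1_norm a * P1_norm b).

Let hnorm_gt0 x : 0 < P1_norm (P1_coord x).
Proof.
rewrite /P1_norm sqrtr_gt0; case: x => [z|].
  by rewrite ltr_wpDl ?sqr_ge0 // (@normc1 R) expr1n.
by rewrite ltr_wpDr ?sqr_ge0 // (@normc1 R) expr1n.
Qed.

Let hinner a b : R[i] := a.1 * conjc b.1 + a.2 * conjc b.2.

Let normc_ge0 (z : R[i]) : 0 <= normc z.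
Proof. by case: z => u v /=; exact: sqrtr_ge0. Qed.

Let sqr_normcE (z : R[i]) : normc z ^+ 2 =
  complex.Re z ^+ 2 + complex.Im z ^+ 2.
Proof. by case: z => u v; rewrite sqr_sqrtr // addr_ge0 ?sqr_ge0. Qed.

Let hnorm_sqr a : P1_norm a ^+ 2 = normc a.1 ^+ 2 + normc a.2 ^+ 2.
Proof. by rewrite sqr_sqrtr // addr_ge0 ?sqr_ge0. Qed.

Let lagrange a b : normc (hinner a b) ^+ 2 + normc (P1_wedge a b) ^+ 2 =
  (P1_norm a * P1_norm b) ^+ 2.
Proof.
rewrite exprMn !hnorm_sqr !sqr_normcE /hinner /P1_wedge.
by move: a b => [[p q] [r s]] [[t u] [v w]] /=; ring.
Qed.

Let cauchy_schwarz a b : normc (hinner a b) <= P1_norm a * P1_norm b.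
Proof.
have h0 : 0 <= P1_norm a * P1_norm b by rewrite mulr_ge0 // sqrtr_ge0.
by rewrite -ler_sqr ?nnegrE // -lagrange lerDl sqr_ge0.
Qed.

Let wedge_split a b c : P1_wedge a c * (P1_norm b ^+ 2)%:C =
  P1_wedge a b * hinner c b + P1_wedge b c * hinner a b.
Proof.
rewrite hnorm_sqr !sqr_normcE /hinner /P1_wedge.
move: a b c => [[p q] [r s]] [[t u] [v w]] [[k l] [m n]] /=.
by apply/eqP; rewrite eq_complex /=; apply/andP; split; apply/eqP; ring.
Qed.

Let chordalxx x : chordal x x = 0.
Proof. by rewrite /chordal /P1_wedge [X in X - _]mulrC subrr (@normc0 R) mul0r. Qed.

Let chordal_eq0 x y : chordal x y = 0 -> x = y.
Proof.
move=> /eqP; rewrite /chordal mulf_eq0 invr_eq0 (gt_eqF (mulr_gt0 _ _)) // orbF.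
move=> /eqP/eq0_normc; rewrite /P1_wedge; case: x y => [z|] [w|] //=.
- by rewrite mul1r mulr1 => /subr0_eq ->.
- by rewrite mulr0 mulr1 sub0r => /eqP; rewrite oppr_eq0 oner_eq0.
- by rewrite mulr1 mul0r subr0 => /eqP; rewrite oner_eq0.
Qed.

Let chordal_sym x y : chordal x y = chordal y x.
Proof.
rewrite /chordal /= [P1_norm (P1_coord y) * _]mulrC.
have -> : P1_wedge (P1_coord x) (P1_coord y) = - P1_wedge (P1_coord y) (P1_coord x).
  by rewrite /P1_wedge; ring.
by rewrite normcN.
Qed.

Let chordal_triangle y x z : chordal x z <= chordal x y + chordal y z.
Proof.
rewrite /chordal /=; move: (hnorm_gt0 x) (hnorm_gt0 y) (hnorm_gt0 z).
move: (P1_coord x) (P1_coord y) (P1_coord z) => a b c a0 b0 c0.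
have key : normc (P1_wedge a c) * P1_norm b ^+ 2 <=
    normc (P1_wedge a b) * (P1_norm c * P1_norm b) +
    normc (P1_wedge b c) * (P1_norm a * P1_norm b).
  have -> : normc (P1_wedge a c) * P1_norm b ^+ 2 =
      normc (P1_wedge a c * (P1_norm b ^+ 2)%:C).
    rewrite normcM; congr (_ * _).
    by rewrite /= expr0n addr0 sqrtr_sqr ger0_norm // sqr_ge0.
  rewrite wedge_split (le_trans (le_normcD _ _)) // !normcM.
  by rewrite lerD // ler_wpM2l // cauchy_schwarz.
have -> : normc (P1_wedge a b) / (P1_norm a * P1_norm b) +
    normc (P1_wedge b c) / (P1_norm b * P1_norm c) =
    (normc (P1_wedge a b) * (P1_norm c * P1_norm b) +
     normc (P1_wedge b c) * (P1_norm a * P1_norm b)) / P1_norm b ^+ 2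
    / (P1_norm a * P1_norm c).
  by field; rewrite !gt_eqF.
by rewrite ler_pM2r ?invr_gt0 ?mulr_gt0 // ler_pdivlMr // exprn_gt0.
Qed.

HB.instance Definition _ := Choice.on (P1 R).
HB.instance Definition _ := Pointed.on (P1 R).
HB.instance Definition _ := isMetric.Build R (P1 R)
  chordalxx chordal_eq0 chordal_sym chordal_triangle.

End ChordalMetric.

Section Dynamics.
Variable R : realType.

(* Infinity is fixed; this is the map induced on P1 only when the polynomial
   is not constant. *)
Definition P1_map (p : {poly R[i]}) (x : P1 R) : P1 R :=
  if x is Some z then Some p.[z] else None.

Definition equicontinuous_iterates_on (p : {poly R[i]}) (U : set (P1 R)) :=
  {in U, equicontinuous [set: nat] (fun n => iter n (P1_map p))}.

(* Equicontinuity being pointwise, the union of all the open sets on which it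
   holds is the largest one: see [fatou_open], [fatou_equicontinuous] and
   [fatou_max]. *)
Definition fatou_set (p : {poly R[i]}) : set (P1 R) :=
  \bigcup_(U in [set U | open U /\ equicontinuous_iterates_on p U]) U.

Lemma fatou_open p : open (fatou_set p).
Proof. by apply: bigcup_open => U []. Qed.

Lemma fatou_equicontinuous p : equicontinuous_iterates_on p (fatou_set p).
Proof. by move=> x /set_mem[U [_ eU] Ux]; apply: eU; exact: mem_set. Qed.

Lemma fatou_max p U :
  open U -> equicontinuous_iterates_on p U -> U `<=` fatou_set p.
Proof. by move=> oU eU x Ux; exists U. Qed.

Definition julia (p : {poly R[i]}) : set (P1 R) := ~` fatou_set p.

Definition filled_julia (p : {poly R[i]}) : set R[i] :=
  [set z | exists M : R, forall n, `|iter n (horner p) z| <= M%:C].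

Definition preper (T : Type) (g : T -> T) : set T :=
  [set x | finite_set (range (fun n => iter n g x))].

Definition critical_interval (f : {poly R}) : set R :=
  [set t | \big[addn/0%N]_(x \in [set x | root (f - t%:P) x])
             mup x (f - t%:P) = (size f).-1].

Definition complex_poly (f : {poly R}) : {poly R[i]} :=
  map_poly (real_complex R) f.

End Dynamics.

(* Main.v *)
(** Only (4) => (1) is not soft, and Montel's theorem can be avoided. Assume
    (4), let [t] be a real preperiodic point, and suppose that a nonreal [x +
    i y] has a bounded orbit. Every iterated preimage of [t] is again a real
    preperiodic point, so [|f^n(z) - t|] is a product of distances from [z] to
    uniformly bounded reals, and replacing [x + i y] by [x] shrinks every
    factor by a uniform ratio. Hence [f^n(x)] tends to [t]; as this holds for
    all [t], there is only one real preperiodic point. Then [t] is its own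
    only preimage and [f = t + c (X - t)^d], but such an [f] has other real
    preperiodic points, at the distance [|c|^(-1/(d-1))] from [t]. So the
    filled Julia set is real, and off it the iterates tend to infinity locally
    uniformly in the chordal metric.

    Conversely, the filled Julia set is relatively clopen in the Fatou set, so
    if the Julia set is real, a nonreal point of the filled Julia set would
    force a whole vertical ray to stay in the filled Julia set. *)
Require Import Defs.
From mathcomp Require Import all_boot all_order all_algebra.
From mathcomp Require Import all_classical all_reals all_analysis.
From mathcomp Require Import complex.
From mathcomp Require Import zify ring lra.

Set Implicit Arguments.
Unset Strict Implicit.
Unset Printing Implicit Defensive.

Import Order.TTheory GRing.Theory Num.Theory.
Import numFieldNormedType.Exports Normc.

Local Open Scope classical_set_scope.
Local Open Scope complex_scope.
Local Open Scope ring_scope.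

(** * Size estimates for complex polynomials *)

Section ComplexPolynomials.
Variable R : realType.
Implicit Types (z w : R[i]) (p : {poly R[i]}).

Lemma normc_ge0 z : 0 <= normc z.
Proof. by case: z => u v /=; exact: sqrtr_ge0. Qed.

Lemma norm_normc z : `|z| = (normc z)%:C.
Proof. by rewrite normc_def; case: z. Qed.

Lemma normc_real (x : R) : normc x%:C = `|x|.
Proof. by rewrite /= expr0n addr0 sqrtr_sqr. Qed.

Lemma normcB z w : normc (z - w) = normc (w - z).
Proof. by rewrite -normcN opprB. Qed.

Lemma ler_normcB z w : normc z - normc w <= normc (z - w).
Proof. by rewrite lerBlDr (le_trans _ (le_normcD _ _)) // subrK. Qed.

Lemma normc_prod (I : Type) (s : seq I) (F : I -> R[i]) :
  normc (\prod_(i <- s) F i) = \prod_(i <- s) normc (F i).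
Proof. by apply: (big_morph _ (@normcM R)); exact: normc1. Qed.

Lemma horner_bounded p (r : R) : 0 <= r ->
  exists2 K, 0 <= K & forall z, normc z <= r -> normc p.[z] <= K.
Proof.
move=> r0; elim/poly_ind: p => [|p c [K K0 pK]].
  by exists 0 => // z _; rewrite horner0 (@normc0 R).
exists (K * r + normc c); first by rewrite addr_ge0 ?mulr_ge0 ?normc_ge0.
move=> z zr; rewrite !hornerE (le_trans (le_normcD _ _)) // lerD2r normcM.
by rewrite ler_pM ?normc_ge0 ?pK.
Qed.

Lemma horner_lipschitz p z : exists2 K, 0 < K &
  forall w, normc (w - z) <= 1 -> normc (p.[w] - p.[z]) <= K * normc (w - z).
Proof.
have /factor_theorem[q qE] : root (p - p.[z]%:P) z.
  by rewrite /root !hornerE subrr.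
have [|K K0 qK] := horner_bounded q (r := normc z + 1).
  by rewrite addr_ge0 ?normc_ge0.
exists (K + 1) => [|w wz]; first by rewrite ltr_wpDl.
have -> : p.[w] - p.[z] = q.[w] * (w - z).
  by have /(congr1 (horner^~ w)) := qE; rewrite !hornerE.
rewrite normcM ler_wpM2r ?normc_ge0 // (le_trans (qK _ _)) ?lerDl //.
by have := le_normcD z (w - z); rewrite addrC subrK; lra.
Qed.

Lemma horner_bounded_below p : p != 0 ->
  exists2 m, 0 < m & exists r, forall z, r <= normc z -> m <= normc p.[z].
Proof.
elim/poly_ind: p => [|p c IH]; first by rewrite eqxx.
have [->|p0 _] := eqVneq p 0.
  rewrite mul0r add0r polyC_eq0 => c0; exists (normc c).
    by rewrite lt_def normc_ge0 andbT; apply: contraNN c0 => /eqP/eq0_normc ->.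
  by exists 0 => z _; rewrite hornerC.
have [m m0 [r pr]] := IH p0; exists 1 => //.
exists (Num.max r ((normc c + 1) / m)) => z.
rewrite ge_max ler_pdivrMr // => /andP[/pr pz zm]; rewrite !hornerE.
have := ler_normcB (p.[z] * z) (- c); rewrite opprK normcN normcM.
by have := ler_wpM2r (normc_ge0 z) pz; lra.
Qed.

(** Write [p = (h X + b) X + c] with [h != 0]. For large [|z|] the inner factor has modulus at least
    3, and the third copy of [|z|] absorbs [c]. *)
Lemma horner_double p : (2 < size p)%N ->
  exists2 r, 0 < r & forall z, r <= normc z -> 2 * normc z <= normc p.[z].
Proof.
elim/poly_ind: p => [|g c _]; first by rewrite size_poly0.
elim/poly_ind: g => [|h b _].
  by rewrite mul0r add0r size_polyC; case: eqP.
have [->|h0 _] := eqVneq h 0.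
  rewrite mul0r add0r size_MXaddC size_polyC.
  by case: ifP => // _; case: (b != 0).
have [m m0 [r hr]] := horner_bounded_below h0.
exists (Num.max (Num.max r ((3 + normc b) / m)) (normc c + 1)).
  by rewrite lt_max ltr_wpDl ?normc_ge0 // orbT.
move=> z; rewrite !ge_max ler_pdivrMr // => /andP[/andP[/hr hz zm] zc].
rewrite !hornerMXaddC.
set g := _ + b.
have gz : 3 <= normc g.
  have := ler_normcB (h.[z] * z) (- b); rewrite opprK normcN normcM -/g.
  by have := ler_wpM2r (normc_ge0 z) hz; lra.
have := ler_normcB (g * z) (- c); rewrite opprK normcN normcM.
by have := ler_wpM2r (normc_ge0 z) gz; have := normc_ge0 z; lra.
Qed.

End ComplexPolynomials.

(** * The critical interval and real-rootedness *)

Section RealRootedPolynomials.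

Lemma poly_split_roots (F : fieldType) (p : {poly F}) : p != 0 ->
  exists s q, p = q * \prod_(x <- s) ('X - x%:P) /\ forall x, ~~ root q x.
Proof.
elim: {p}(size p) {-2}p (leqnn (size p)) => [|n IH] p.
  by rewrite leqn0 size_poly_eq0 => ->.
move=> sp p0; have [[x px]|noroot] := pselect (exists x, root p x); last first.
  exists [::], p; rewrite big_nil mulr1; split=> // x.
  by apply/negP => px; apply: noroot; exists x.
have [q qE] := factor_theorem _ _ px.
have q0 : q != 0 by apply: contraNneq p0 => q0; rewrite qE q0 mul0r.
have [|s [r [rE nr]]] := IH q _ q0.
  by move: sp; rewrite qE size_Mmonic ?monicXsubC // size_XsubC addn2.
by exists (x :: s), r; rewrite big_cons qE rE; split=> //; ring.
Qed.

(** The root-free factor [q] adds nothing to multiplicities, so [mup x p] counts the occurrences of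
    [x] in [s]. *)
Lemma sum_mup_roots (F : fieldType) (q : {poly F}) (s : seq F) :
  (forall x, ~~ root q x) ->
  let p := q * \prod_(x <- s) ('X - x%:P) in
  \big[addn/0%N]_(x \in [set x | root p x]) mup x p = size s.
Proof.
move=> nq p.
have mupE x : mup x p = count_mem x s by rewrite mupMr // mu_prod_XsubC.
have rootE x : root p x = (x \in s).
  by rewrite rootM (negPf (nq x)) root_prod_XsubC.
rewrite (fsbigE (undup s)) ?undup_uniq //=; first last.
- by move=> x _; rewrite mem_undup mupE => /count_memPn.
- by move=> x /=; rewrite mem_undup rootE.
rewrite big_seq_cond (eq_bigl (mem (undup s))) => [|x]; last first.
  rewrite andb_idr // mem_undup -rootE => ?; exact: mem_set.
rewrite -big_seq -sum1_size -(big_undup_iterop_count _ s predT (fun=> 1%N)).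
by apply: eq_bigr => x _; rewrite Monoid.iteropE iter_addn mul1n addn0 mupE.
Qed.

Variable R : realType.
Implicit Types (f p : {poly R}) (x t : R) (z : R[i]).

Lemma size_polyBC f t : (1 < size f)%N -> size (f - t%:P) = size f.
Proof.
move=> f1; rewrite size_polyDl // size_polyN.
exact: leq_ltn_trans (size_polyC_leq1 _) f1.
Qed.

(** As many roots as the degree leave only a constant for the root-free factor. *)
Lemma critical_interval_split f t : (1 < size f)%N -> critical_interval f t ->
  exists c s, f - t%:P = c *: \prod_(x <- s) ('X - x%:P).
Proof.
move=> f1; have := size_polyBC t f1; rewrite /critical_interval /=.
have [s [q [-> nq]]] : exists s q,
    f - t%:P = q * \prod_(x <- s) ('X - x%:P) /\ forall x, ~~ root q x.
  by apply: poly_split_roots; rewrite -size_poly_gt0 size_polyBC // ltnW.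
rewrite (sum_mup_roots s nq) size_Mmonic ?monic_prod_XsubC //; last first.
  by apply/eqP => q0; have := nq 0; rewrite q0 root0.
rewrite size_prod_XsubC => + ss.
rewrite addnS /= => sq.
have /size_poly1P[c c0 ->] : size q == 1%N.
  by rewrite -(eqn_add2r (size s)) [X in X == _]sq ss add1n prednK // ltnW.
by exists c, s; rewrite mul_polyC.
Qed.

(** A nonconstant root-free factor would have a complex root, which is real by assumption and so a
    root in [R] after all. *)
Lemma critical_interval_real_roots f t : (1 < size f)%N ->
  (forall z, root (complex_poly (f - t%:P)) z -> range (fun x : R => x%:C) z) ->
  critical_interval f t.
Proof.
move=> f1 realroots; have := size_polyBC t f1; rewrite /critical_interval /=.
have [s [q [pE nq]]] : exists s q,
    f - t%:P = q * \prod_(x <- s) ('X - x%:P) /\ forall x, ~~ root q x.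
  by apply: poly_split_roots; rewrite -size_poly_gt0 size_polyBC // ltnW.
rewrite pE (sum_mup_roots s nq) size_Mmonic ?monic_prod_XsubC //; last first.
  by apply/eqP => q0; have := nq 0; rewrite q0 root0.
have [/eqP sq|sq] := eqVneq (size (complex_poly q)) 1%N.
  rewrite size_map_poly in sq.
  by rewrite (eqP sq) size_prod_XsubC => <-.
have [z qz] := closed_rootP _ sq.
have [x _ /= xz] : range (fun x : R => x%:C) z.
  by apply: realroots; rewrite pE /complex_poly rmorphM rootM qz.
by move: qz; rewrite -xz fmorph_root (negPf (nq x)).
Qed.

End RealRootedPolynomials.

(** * Preperiodic points and bounded orbits *)

Section PreperiodicPoints.

(** The two orbits differ at most by the point [x]. From right to left this is forward invariance,
    from left to right closure under preimages. *)
Lemma preper_stepE (T : Type) (g : T -> T) (x : T) :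
  preper g (g x) <-> preper g x.
Proof.
rewrite /preper /=; split=> gx.
  apply: (@sub_finite_set _ _ ([set x] `|` range (fun n => iter n g (g x)))).
    move=> _ [[|n] _ <-]; first by left.
    by right; exists n => //; rewrite -iterSr.
  by rewrite finite_setU; split=> //; exact: finite_set1.
apply: sub_finite_set gx => _ [n _ <-].
by exists n.+1 => //; rewrite iterSr.
Qed.

Lemma fixed_preper (T : Type) (g : T -> T) (x : T) : g x = x -> preper g x.
Proof.
move=> gx; apply: (@sub_finite_set _ _ [set x]); last exact: finite_set1.
by move=> _ [n _ <-]; elim: n => //= n ->.
Qed.

Variable R : realType.
Implicit Types (f : {poly R}) (x t : R) (p : {poly R[i]}) (z : R[i]).

Lemma filled_juliaP p z : filled_julia p z <->
  exists M : R, forall n, normc (iter n (horner p) z) <= M.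
Proof.
by split=> -[M zM]; exists M => n; have := zM n; rewrite norm_normc lecR.
Qed.

Lemma preper_filled_julia p z : preper (horner p) z -> filled_julia p z.
Proof.
rewrite /preper /= finite_seqP => -[s sE]; apply/filled_juliaP.
exists (\sum_(w <- s) normc w) => n.
have : [set` s] (iter n (horner p) z) by rewrite -sE; exists n.
move=> /= /[dup] zs /(big_rem _) ->.
by rewrite lerDl sumr_ge0 // => w _; exact: normc_ge0.
Qed.

Lemma horner_complex_poly f x : (complex_poly f).[x%:C] = f.[x]%:C.
Proof. exact: horner_map. Qed.

Lemma iter_complex_poly f x n :
  iter n (horner (complex_poly f)) x%:C = (iter n (horner f) x)%:C.
Proof. by elim: n => //= n ->; exact: horner_complex_poly. Qed.

Lemma preper_complex_poly f x :
  preper (horner f) x <-> preper (horner (complex_poly f)) x%:C.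
Proof.
rewrite /preper /= (_ : range (fun n => iter n _ x%:C) =
    real_complex R @` range (fun n => iter n (horner f) x)); last first.
  rewrite image_comp; apply: eq_imagel => n _ /=; exact: iter_complex_poly.
split=> [|fin]; first exact: finite_image.
apply: sub_finite_set (@preimage_image _ _ (real_complex R) _) _.
by apply: finite_preimage fin => ? ? _ _; exact: complexI.
Qed.

End PreperiodicPoints.

(** * Escape to infinity beyond a fixed radius *)

Section EscapeRadius.
Variables (R : realType) (p : {poly R[i]}) (rho : R).
Hypothesis rho_gt0 : 0 < rho.
Hypothesis escape : forall z, rho <= normc z -> 2 * normc z <= normc p.[z].

Lemma iter_escape n z : rho <= normc z ->
  2 ^+ n * normc z <= normc (iter n (horner p) z).
Proof.
move=> rz; elim: n => [|n IH]; first by rewrite expr0 mul1r.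
rewrite exprS -mulrA (le_trans _ (escape _)) ?ler_pM2l //.
apply: le_trans (le_trans rz _) IH.
by rewrite ler_peMl ?normc_ge0 // exprn_ege1 // ler1n.
Qed.

Lemma filled_julia_step z : filled_julia p z -> filled_julia p p.[z].
Proof. by move=> [M zM]; exists M => n; rewrite -iterSr. Qed.

Lemma filled_julia_lt z : filled_julia p z -> normc z < rho.
Proof.
move=> /filled_juliaP[M zM]; rewrite ltNge; apply/negP => rz.
have z0 : 0 < normc z by exact: lt_le_trans rz.
have [n] : exists n, M < 2 ^+ n * normc z.
  pose k := Num.bound (M / normc z); exists k; rewrite -ltr_pdivrMr //.
  rewrite (lt_le_trans (archi_boundP _)) //.
    by rewrite divr_ge0 ?normc_ge0 // (le_trans _ (zM 0)) ?normc_ge0.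
  by rewrite -natrX ler_nat ltnW // ltn_expl.
by rewrite ltNge (le_trans (iter_escape n rz)).
Qed.

(** Invariance turns the bound on single points into one bound [rho] for all bounded orbits. *)
Lemma filled_julia_escapeP z :
  filled_julia p z <-> forall n, normc (iter n (horner p) z) < rho.
Proof.
split=> [zJ n|zr]; last by apply/filled_juliaP; exists rho => n; rewrite ltW.
apply: filled_julia_lt.
by elim: n => //= n; exact: filled_julia_step.
Qed.

End EscapeRadius.

(** * Real preperiodic points in the critical interval force a real filled Julia set *)

Section RealPreperiodicPoints.
Variables (R : realType) (f : {poly R}).
Hypothesis size_f : (2 < size f)%N.
Hypothesis preper_crit : preper (horner f) `<=` critical_interval f.

Let F := complex_poly f.

Lemma preper_factor t : preper (horner f) t -> exists c s, [/\ c != 0,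
  (1 < size s)%N, f - t%:P = c *: \prod_(x <- s) ('X - x%:P) &
  forall x, x \in s -> preper (horner f) x].
Proof.
move=> pt; have f1 := ltnW size_f.
have [c [s fE]] := critical_interval_split f1 (preper_crit pt).
have sizeE := size_polyBC t f1.
have c0 : c != 0.
  by apply: contraTneq f1 => c0; rewrite -sizeE fE c0 scale0r size_poly0.
exists c, s; split=> //.
  by rewrite -ltnS -(size_prod_XsubC s id) -(size_scale _ c0) -fE sizeE.
move=> x xs; apply/preper_stepE.
suff -> : f.[x] = t by [].
have : root (f - t%:P) x by rewrite fE rootZ ?root_prod_XsubC.
by rewrite /root !hornerE subr_eq0 => /eqP.
Qed.

Lemma complex_poly_factor t c s (w : R[i]) :
  f - t%:P = c *: \prod_(x <- s) ('X - x%:P) ->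
  F.[w] - t%:C = c%:C * \prod_(x <- s) (w - x%:C).
Proof.
move=> /(congr1 (fun q => (complex_poly q).[w])).
rewrite /complex_poly rmorphB linearZ /= rmorph_prod /= map_polyC /=.
rewrite !hornerE horner_prod => ->; congr (_ * _); apply: eq_bigr => x _.
by rewrite rmorphB /= map_polyX map_polyC !hornerE.
Qed.

(** The ratio of [|u|] to the length of [u + i y] increases with [|u|], so its value at [K] is the
    worst case. *)
Lemma ratio_le (K y u : R) : 0 < K -> `|u| <= K ->
  `|u| <= K / Num.sqrt (K ^+ 2 + y ^+ 2) * Num.sqrt (u ^+ 2 + y ^+ 2).
Proof.
move=> K0 uK; have Ky : 0 < K ^+ 2 + y ^+ 2.
  by rewrite ltr_pwDl ?exprn_gt0 ?sqr_ge0.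
rewrite mulrAC ler_pdivlMr ?sqrtr_gt0 //.
rewrite -ler_sqr ?nnegrE ?mulr_ge0 ?sqrtr_ge0 ?(ltW K0) //.
rewrite !exprMn !sqr_sqrtr ?addr_ge0 ?sqr_ge0 //.
have uK2 : u ^+ 2 <= K ^+ 2.
  by rewrite -[u ^+ 2]real_normK ?num_real // ler_sqr ?nnegrE // ltW.
rewrite real_normK ?num_real //.
by have := ler_wpM2r (sqr_ge0 y) uK2; lra.
Qed.

Variable rho : R.
Hypothesis rho_gt0 : 0 < rho.
Hypothesis escape : forall z, rho <= normc z -> 2 * normc z <= normc F.[z].

Lemma preper_lt t : preper (horner f) t -> `|t| < rho.
Proof.
move=> pt; rewrite -normc_real; apply: (filled_julia_lt rho_gt0 escape).
exact/preper_filled_julia/preper_complex_poly.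
Qed.

(* All preimages of a preperiodic [t] are real preperiodic points, so
   [|F w - t|] is a product of distances from [w] to preperiodic points; each
   of these shrinks when a nonreal point is projected to the real line. *)
Lemma preper_contraction (x y : R) : y != 0 -> exists2 c : R, 0 <= c < 1 &
  forall n t, preper (horner f) t ->
    normc (iter n (horner F) x%:C - t%:C) <=
      c ^+ n.+1 * normc (iter n (horner F) (x +i* y) - t%:C).
Proof.
(* [K] bounds the distance from [x] to every real preperiodic point, which makes the ratio [c]
   uniform. *)
move=> y0; pose K := `|x| + rho.
have K0 : 0 < K by rewrite ltr_wpDl.
have y2 : 0 < y ^+ 2 by rewrite exprn_even_gt0.
have Ky : 0 < K ^+ 2 + y ^+ 2 by rewrite addr_gt0 // exprn_gt0.
have s0 : 0 < Num.sqrt (K ^+ 2 + y ^+ 2) by rewrite sqrtr_gt0.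
pose c := K / Num.sqrt (K ^+ 2 + y ^+ 2).
have c0 : 0 <= c by rewrite divr_ge0 ?ltW.
have c1 : c < 1.
  rewrite ltr_pdivrMr // mul1r -[ltLHS](ger0_norm (ltW K0)) -sqrtr_sqr.
  by rewrite ltr_sqrt ?ltrDl.
exists c; first by rewrite c0.
elim=> [|n IH] t pt.
  rewrite expr1 /= subr0 oppr0 addr0 expr0n /= addr0 sqrtr_sqr ratio_le //.
  by rewrite (le_trans (ler_normB _ _)) // lerD2l ltW // preper_lt.
have [a [s [a0 s1 fE ps]]] := preper_factor pt.
rewrite !iterS !(complex_poly_factor _ fE) !normcM mulrCA.
rewrite ler_wpM2l ?normc_ge0 // !normc_prod.
set u := iter n _ _ in IH *; set v := iter n _ _ in IH *.
have : \prod_(r <- s) normc (u - r%:C) <=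
    \prod_(r <- s) (c ^+ n.+1 * normc (v - r%:C)).
  rewrite big_seq [leRHS]big_seq; apply: ler_prod => r /ps pr.
  by rewrite normc_ge0 IH.
move=> /le_trans; apply.
rewrite big_split /= big_const_seq count_predT iter_mulr_1 -exprM.
apply: ler_wpM2r; first by rewrite prodr_ge0 // => r _; exact: normc_ge0.
(* At least two roots, each contributing [c ^+ n.+1], give an exponent of at least [2 * n.+1], hence
   at least [n.+2]. *)
rewrite ler_wiXn2l ?(ltW c1) //.
by rewrite (leq_trans _ (leq_mul (leqnn _) s1)) //; lia.
Qed.

(** The bounded orbit of [x + i y] stays within [2 * rho] of [t] and of [t'], so by contraction the
    orbit of [x] tends to both. *)
Lemma filled_julia_preper_unique (x y t t' : R) : y != 0 ->
  filled_julia F (x +i* y) -> preper (horner f) t -> preper (horner f) t' ->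
  t = t'.
Proof.
move=> y0 zJ pt pt'; have [c /andP[c0 c1] cle] := preper_contraction x y0.
have dist_le u n : preper (horner f) u ->
    normc (iter n (horner F) x%:C - u%:C) <= c ^+ n * (2 * rho).
  move=> pu; apply: le_trans (cle n u pu) _.
  rewrite exprSr -mulrA ler_wpM2l ?exprn_ge0 //.
  rewrite -[leRHS]mul1r ler_pM ?normc_ge0 ?(ltW c1) //.
  rewrite (le_trans (le_normcD _ _)) // normcN mulr_natl mulr2n.
  rewrite lerD //; last by rewrite normc_real ltW // preper_lt.
  exact/ltW/(filled_julia_escapeP rho_gt0 escape _).1.
apply/eqP; rewrite -subr_eq0 -normr_le0.
apply/ler_addgt0Pl => e e0; rewrite addr0.
(* Two distances of at most [c ^+ N * (2 * rho)] must add up to at most [e]. *)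
have /cvgr0_norm_lt-/(_ (e / (4 * rho)))[] : GRing.exp c @ \oo --> (0 : R).
- by apply: cvg_expr; rewrite ger0_norm.
- by rewrite divr_gt0 // mulr_gt0.
move=> N _ /(_ N (leqnn N)) /=.
rewrite ger0_norm ?exprn_ge0 // ltr_pdivlMr ?mulr_gt0 // => cN.
rewrite -normc_real; set v := iter N (horner F) x%:C in dist_le.
have -> : (t - t')%:C = (t%:C - v) + (v - t'%:C) by rewrite addrA subrK rmorphB.
rewrite (le_trans (le_normcD _ _)) // normcB.
by have := dist_le t N pt; have := dist_le t' N pt'; rewrite -/v; lra.
Qed.

(* On the sphere of radius [|c| ^ (-1/k)] around [t], the map
   [w |-> t + c (w - t) ^ k.+1] preserves the distance to [t]. *)
Lemma exceptional_preper (t c : R) (k : nat) : c != 0 -> (0 < k)%N ->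
  (forall w, f.[w] = t + c * (w - t) ^+ k.+1) ->
  exists2 u, u != t & preper (horner f) u.
Proof.
move=> c0 k0 fE; pose y := `|c|^-1 `^ k%:R^-1.
have y0 : 0 < y by rewrite powR_gt0 // invr_gt0 normr_gt0.
have yk : `|c| * y ^+ k = 1.
  rewrite -powR_mulrn ?ltW // -powRrM mulVf ?pnatr_eq0 -?lt0n // powRr1.
    by rewrite mulfV // normr_eq0.
  by rewrite invr_ge0.
exists (t + y); first by rewrite -subr_eq0 addrAC subrr add0r gt_eqF.
have sphere n : `|iter n (horner f) (t + y) - t| = y.
  elim: n => [|n IH]; first by rewrite /= addrAC subrr add0r gtr0_norm.
  by rewrite iterS fE addrAC subrr add0r normrM normrX IH exprSr mulrA yk mul1r.
(* On the real line the sphere has only two points, so the orbit is finite whatever the sign of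
   [c]. *)
apply: (@sub_finite_set _ _ ([set t + y] `|` [set t - y])).
  move=> _ [n _ <-]; have /eqP := sphere n.
  rewrite eqr_norml => /andP[/orP[]/eqP h _]; [left|right];
    by rewrite /= -[LHS](subrK t) h addrC.
by rewrite finite_setU; split; exact: finite_set1.
Qed.

Lemma filled_julia_real : preper (horner f) !=set0 ->
  filled_julia F `<=` range (fun x : R => x%:C).
Proof.
move=> [t pt] [x y] zJ; have [->|y0] := eqVneq y 0; first by exists x.
have [c [s [c0 s1 fE ps]]] := preper_factor pt.
have st r : r \in s -> r = t.
  by move=> /ps pr; exact: filled_julia_preper_unique y0 zJ pr pt.
(* All roots being [t], the exponent [k.+1] is [size s]; two roots at least make [k] positive. *)
have [] := @exceptional_preper t c (size s).-1 c0.
- by rewrite -ltnS prednK // ltnW.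
- move=> w; rewrite prednK 1?ltnW //.
  have /(congr1 (horner^~ w)) := fE.
  rewrite !hornerE horner_prod (eq_big_seq (fun=> w - t)) => [|r /st ->].
    rewrite big_const_seq count_predT iter_mulr_1 => <-; ring.
  by rewrite !hornerE.
- move=> u /eqP ut pu; case: ut.
  exact: filled_julia_preper_unique y0 zJ pu pt.
Qed.

End RealPreperiodicPoints.

(** * Chordal and Euclidean distance compared *)

Section ChordalTopology.
Variable R : realType.
Implicit Types (z w : R[i]) (x y : P1 R).

(** This is [P1_norm] of the coordinates [(z, 1)], the inverse of the chordal distance from [z] to
    infinity. *)
Let height z : R := Num.sqrt (normc z ^+ 2 + 1).

Let height_gt0 z : 0 < height z.
Proof. by rewrite sqrtr_gt0 ltr_wpDl ?sqr_ge0. Qed.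

Let height_ge1 z : 1 <= height z.
Proof. by rewrite -[leLHS]sqrtr1 ler_wsqrtr // lerDr sqr_ge0. Qed.

Let normc_le_height z : normc z <= height z.
Proof.
by rewrite -[leLHS]ger0_norm ?normc_ge0 // -sqrtr_sqr ler_wsqrtr // lerDl.
Qed.

Let height_le z : height z <= normc z + 1.
Proof.
rewrite -ler_sqr ?nnegrE ?sqrtr_ge0 ?addr_ge0 ?normc_ge0 //.
rewrite sqr_sqrtr ?addr_ge0 ?sqr_ge0 //.
by have := normc_ge0 z; lra.
Qed.

Lemma chordal_finite z w : mdist (Some z : P1 R) (Some w : P1 R) =
  normc (z - w) / (Num.sqrt (normc z ^+ 2 + 1) * Num.sqrt (normc w ^+ 2 + 1)).
Proof.
transitivity (normc (z * 1 - 1 * w) / (Num.sqrt (normc z ^+ 2 + normc 1 ^+ 2) *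
    Num.sqrt (normc w ^+ 2 + normc 1 ^+ 2))) => //.
by rewrite mulr1 mul1r normc1 expr1n.
Qed.

Lemma chordal_infty z :
  mdist (Some z : P1 R) (None : P1 R) = (Num.sqrt (normc z ^+ 2 + 1))^-1.
Proof.
transitivity (normc (z * 0 - 1 * 1) / (Num.sqrt (normc z ^+ 2 + normc 1 ^+ 2) *
    Num.sqrt (normc 1 ^+ 2 + normc 0 ^+ 2))) => //.
rewrite mulr0 mulr1 sub0r normcN normc1 normc0 expr1n expr0n addr0.
by rewrite sqrtr1 mulr1 mul1r.
Qed.

Lemma chordal_le z w : mdist (Some z : P1 R) (Some w : P1 R) <= normc (z - w).
Proof.
rewrite chordal_finite ler_pdivrMr ?mulr_gt0 ?height_gt0 //.
by rewrite ler_peMr ?normc_ge0 // mulr_ege1 ?height_ge1.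
Qed.

Lemma chordal_infty_le z (r : R) : 0 < r -> r <= normc z ->
  mdist (Some z : P1 R) (None : P1 R) <= r^-1.
Proof.
move=> r0 rz; rewrite chordal_infty lef_pV2 ?posrE ?height_gt0 //.
exact: le_trans (normc_le_height z).
Qed.

Lemma chordal_infty_ge z (r : R) : normc z <= r ->
  (r + 1)^-1 <= mdist (Some z : P1 R) (None : P1 R).
Proof.
move=> zr; rewrite chordal_infty lef_pV2 ?posrE ?height_gt0 //.
  by rewrite (le_trans (height_le z)) // lerD2r.
by rewrite ltr_wpDl // (le_trans (normc_ge0 z)).
Qed.

Lemma normc_le_chordal z (e : R) : 0 < e ->
  e <= mdist (Some z : P1 R) (None : P1 R) -> normc z <= e^-1.
Proof.
move=> e0; rewrite chordal_infty -[e in e <= _]invrK.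
rewrite lef_pV2 ?posrE ?invr_gt0 ?height_gt0 //.
exact: le_trans (normc_le_height z).
Qed.

Lemma near_finite z (e : R) : 0 < e -> \forall y \near (Some z : P1 R),
  if y is Some w then normc (w - z) < e else false.
Proof.
move=> e0; pose h := height z; have h0 : 0 < h by exact: height_gt0.
(* The first bound excludes infinity and forces [height w <= 2 * h]; the second then gives [e] once
   the denominator [h * height w] is cleared. *)
have r0 : 0 < Num.min (2 * h)^-1 (e / (2 * h ^+ 2)).
  by rewrite lt_min invr_gt0 divr_gt0 ?mulr_gt0 ?exprn_gt0.
apply: filterS (near_ball (Some z : P1 R) _ r0) => -[w|];
    rewrite ballEmdist /= lt_min => /andP[]; last first.
  rewrite chordal_infty -/(height z) -/h => + _.
  rewrite ltf_pV2 ?posrE ?mulr_gt0 //; lra.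
move=> d1 d2.
have wh : height w <= 2 * h.
  have := metric_triangle (Some z : P1 R) (Some w : P1 R) (None : P1 R).
  rewrite !chordal_infty -/(height z) -/(height w) -/h => tri.
  rewrite -lef_pV2 ?posrE ?mulr_gt0 ?height_gt0 //.
  have : h^-1 = (2 * h)^-1 + (2 * h)^-1 by field; rewrite gt_eqF.
  lra.
move: d2; rewrite chordal_finite -/(height z) -/(height w) -/h normcB.
rewrite ltr_pdivrMr ?mulr_gt0 ?height_gt0 // => /lt_le_trans; apply.
rewrite mulrAC ler_pdivrMr ?mulr_gt0 ?exprn_gt0 // ler_pM2l //.
by have := ler_wpM2l (ltW h0) wh; lra.
Qed.

Lemma near_infty (M : R) : \forall y \near (None : P1 R),
  if y is Some w then M < normc w else true.
Proof.
have M0 : 0 < (`|M| + 1)^-1 by rewrite invr_gt0 ltr_wpDl.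
apply: filterS (near_ball (None : P1 R) _ M0) => -[w|//].
rewrite ballEmdist /= metric_sym => d.
rewrite (le_lt_trans (ler_norm M)) // ltNge; apply/negP => /chordal_infty_ge.
by rewrite leNgt d.
Qed.

Definition P1_outside (r : R) : set (P1 R) :=
  [set y | if y is Some w then r < normc w else true].

Lemma open_P1_outside r : open (P1_outside r).
Proof.
rewrite openE => -[z|] /= zr; last first.
  by apply: filterS (near_infty r) => -[].
have d0 : 0 < normc z - r by rewrite subr_gt0.
apply: filterS (near_finite z d0) => -[w|//] /= wz.
by have := ler_normcB z w; rewrite normcB /P1_outside /=; lra.
Qed.

Lemma P1_continuousP (g : P1 R -> P1 R) : continuous g <->
  forall x (e : R), 0 < e -> \forall y \near x, mdist (g x) (g y) < e.
Proof.
split=> [gc x e e0|gc x A /nbhs_ballP[e /= e0 eA]].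
  by have := gc x _ (near_ball (g x) _ e0); rewrite ballEmdist.
apply: filterS (gc x e e0) => y xy.
by apply: eA; rewrite ballEmdist.
Qed.

End ChordalTopology.

(** * The basin of infinity and the Fatou set *)

Section FatouSet.
Variables (R : realType) (p : {poly R[i]}) (rho : R).
Hypothesis rho_gt0 : 0 < rho.
Hypothesis escape : forall z, rho <= normc z -> 2 * normc z <= normc p.[z].

Let G : P1 R -> P1 R := P1_map p.

Lemma iter_P1_map n z : iter n G (Some z) = Some (iter n (horner p) z).
Proof. by elim: n => //= n ->. Qed.

Lemma iter_P1_map_infty n : iter n G None = None.
Proof. by elim: n => //= n ->. Qed.

(** A local Lipschitz bound serves at finite points; at infinity the doubling of the modulus
    does. *)
Lemma P1_map_continuous : continuous G.
Proof.
apply/P1_continuousP => -[z|] e e0.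
  have [K K0 pK] := horner_lipschitz p z.
  have d0 : 0 < Num.min 1 (e / K) by rewrite lt_min ltr01 divr_gt0.
  apply: filterS (near_finite z d0) => -[w|//] /=.
  rewrite lt_min => /andP[/ltW/pK pwz]; rewrite ltr_pdivlMr // mulrC => we.
  apply: le_lt_trans (chordal_le _ _) _.
  by rewrite normcB (le_lt_trans pwz).
apply: filterS (near_infty (Num.max rho e^-1)) => -[w|] /=; last first.
  by move=> _; rewrite mdistxx.
rewrite gt_max => /andP[/ltW/escape wp ew]; rewrite metric_sym.
have ew2 : e^-1 < 2 * normc w by have := normc_ge0 w; lra.
have w0 : 0 < 2 * normc w by rewrite (lt_trans _ ew2) // invr_gt0.
apply: le_lt_trans (chordal_infty_le w0 wp) _.
by rewrite -[ltRHS]invrK ltf_pV2 ?posrE // invr_gt0.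
Qed.

Lemma iter_P1_map_continuous n : continuous (iter n G).
Proof.
elim: n => [x|n IH x]; first exact: cvg_id.
apply: (@continuous_comp _ _ _ (iter n G) G); first exact: IH.
exact: P1_map_continuous.
Qed.

(** The rate does not depend on [x]: convergence to infinity is uniform here. *)
Lemma outside_chordal_infty n x : P1_outside rho x ->
  mdist (iter n G x) (None : P1 R) <= (2 ^+ n * rho)^-1.
Proof.
case: x => [z|] /= zr; last first.
  by rewrite iter_P1_map_infty mdistxx invr_ge0 mulr_ge0 ?exprn_ge0 // ltW.
rewrite iter_P1_map; apply: chordal_infty_le.
  by rewrite mulr_gt0 ?exprn_gt0.
apply: le_trans (iter_escape escape n (ltW zr)).
by rewrite ler_pM2l ?exprn_gt0 // ltW.
Qed.

(** The basin of attraction of infinity, with infinity itself included. *)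
Let basin : set (P1 R) := ~` (Some @` filled_julia p).

Lemma basin_escape x : basin x -> exists m, P1_outside rho (iter m G x).
Proof.
case: x => [z|] zJ; last by exists 0%N.
have [m zm] : exists m, rho <= normc (iter m (horner p) z).
  apply: contrapT => nesc; apply: zJ; exists z => //.
  apply/(filled_julia_escapeP rho_gt0 escape) => n; rewrite ltNge.
  by apply/negP => zn; apply: nesc; exists n.
(* One more iterate turns the weak inequality into the strict one of [P1_outside]. *)
exists m.+1; rewrite iter_P1_map; apply: lt_le_trans (escape zm).
by move: zm; set v := normc _; have := rho_gt0; lra.
Qed.

Lemma near_basin_escape x : basin x ->
  exists m, \forall y \near x, P1_outside rho (iter m G y).
Proof.
move=> /basin_escape[m xm]; exists m.
suff : nbhs (iter m G x) (P1_outside rho) by exact: iter_P1_map_continuous.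
by apply: open_nbhs_nbhs; split=> //; exact: open_P1_outside.
Qed.

Lemma outside_basin m x : P1_outside rho (iter m G x) -> basin x.
Proof.
move=> + [z zJ zx]; rewrite -zx iter_P1_map /= ltNge => /negP; apply.
by rewrite ltW //; exact: (filled_julia_escapeP rho_gt0 escape _).1.
Qed.

Lemma open_basin : open basin.
Proof.
rewrite openE => x /near_basin_escape[m xm].
by apply: filterS xm => y; exact: outside_basin.
Qed.

(** Near [x] all orbits are outside the disc at a common time [m], and from [N + m] on they are
    within [e / 2] of infinity. The finitely many earlier iterates are handled by continuity. *)
Lemma equicontinuous_basin : equicontinuous_iterates_on p basin.
Proof.
move=> x /set_mem xB E; rewrite -entourage_from_ballE => -[e /= e0 eE].
have [m xm] := near_basin_escape xB.
have [N Ne] : exists N, (2 ^+ N * rho)^-1 < e / 2.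
  (* An archimedean bound suffices, as [n < 2 ^ n]. *)
  exists (Num.bound (2 / (e * rho))).
  have b0 : 2 / (e * rho) < 2 ^+ Num.bound (2 / (e * rho)).
    rewrite (lt_le_trans (archi_boundP _)) //.
      by rewrite divr_ge0 ?mulr_ge0 ?(ltW e0) ?(ltW rho_gt0).
    by rewrite -natrX ler_nat ltnW // ltn_expl.
  rewrite invf_plt ?posrE ?mulr_gt0 ?exprn_gt0 ?divr_gt0 //.
  rewrite -ltr_pdivrMr //; apply: le_lt_trans b0.
  by rewrite invf_div invfM mulrA.
have near_small : forall k, \forall y \near x,
    forall n, (n < k)%N -> mdist (iter n G x) (iter n G y) < e.
  elim=> [|k IH]; first by apply: filterS xm => y _ n.
  have /(_ x e e0) := (P1_continuousP _).1 (@iter_P1_map_continuous k).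
  apply: filterS2 IH => y yn yk n; rewrite ltnS leq_eqVlt => /predU1P[->//|].
  exact: yn.
have xm0 := nbhs_singleton xm.
apply: filterS2 (near_small (N + m)%N) xm => y small ym n _.
apply: eE; rewrite /= ballEmdist /=.
have [/small//|mn] := ltnP n (N + m).
have far u : P1_outside rho (iter m G u) ->
    mdist (iter n G u) (None : P1 R) < e / 2.
  move=> um; apply: le_lt_trans Ne.
  rewrite -(subnK (leq_trans (leq_addl N m) mn)) iterD.
  apply: le_trans (outside_chordal_infty _ um) _.
  rewrite lef_pV2 ?posrE ?mulr_gt0 ?exprn_gt0 // ler_pM2r //.
  rewrite ler_weXn2l ?ler1n // leq_subRL ?(leq_trans (leq_addl N m)) //.
  by rewrite addnC.
apply: le_lt_trans (metric_triangle _ (None : P1 R) _) _.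
by rewrite [mdist (None : P1 R) _]metric_sym [ltRHS]splitr ltrD // far.
Qed.

Lemma basin_fatou : basin `<=` fatou_set p.
Proof. exact: fatou_max open_basin equicontinuous_basin. Qed.

(** Bounded orbits keep a chordal distance of at least [k] from infinity. Orbits that stay within
    [k / 2] of one another are therefore bounded together. *)
Lemma fatou_filled_julia_locally_constant z : fatou_set p (Some z) ->
  exists2 d, 0 < d & forall w, normc (w - z) < d ->
    (filled_julia p w <-> filled_julia p z).
Proof.
move=> zF; pose k := (rho + 1)^-1.
have k0 : 0 < k / 2 by rewrite divr_gt0 // invr_gt0 addr_gt0.
have half a b : (forall n, mdist (Some (iter n (horner p) a) : P1 R)
    (Some (iter n (horner p) b) : P1 R) < k / 2) ->
    filled_julia p a -> filled_julia p b.
  move=> ab aJ; apply/filled_juliaP; exists (k / 2)^-1 => n.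
  apply: normc_le_chordal => //.
  have an := (filled_julia_escapeP rho_gt0 escape _).1 aJ n.
  have := chordal_infty_ge (ltW an); rewrite -/k => ka.
  have := metric_triangle (Some (iter n (horner p) a) : P1 R)
    (Some (iter n (horner p) b) : P1 R) (None : P1 R).
  by have := ab n; lra.
have zE : entourage [set xy : P1 R * P1 R | ball xy.1 (k / 2) xy.2].
  by rewrite -entourage_from_ballE; exists (k / 2).
have /nbhs_ballP[d /= d0 near_z] := fatou_equicontinuous (mem_set zF) zE.
exists d => // w wz.
have zw n : mdist (Some (iter n (horner p) z) : P1 R)
    (Some (iter n (horner p) w) : P1 R) < k / 2.
  have zdw : ball (Some z : P1 R) d (Some w : P1 R).
    rewrite ballEmdist /=; apply: le_lt_trans (chordal_le _ _) _.
    by rewrite normcB.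
  by have := near_z _ zdw n I; rewrite !iter_P1_map ballEmdist.
by split; apply: half => n //; rewrite metric_sym.
Qed.

(** On the vertical ray [x + i s y], [s >= 1], take the last parameter in the filled Julia set. That
    point is not real, hence in the Fatou set, and local constancy pushes the parameter further. *)
Lemma filled_julia_real_of_julia :
  julia p `<=` range (fun x : R => Some x%:C) ->
  filled_julia p `<=` range (fun x : R => x%:C).
Proof.
move=> Jreal [x y] zJ; have [->|y0] := eqVneq y 0; first by exists x.
have normy (r s : R) :
    normc ((x +i* (r * y)) - (x +i* (s * y))) = `|r - s| * `|y|.
  by rewrite /= subrr expr0n add0r sqrtr_sqr -mulrBl normrM.
have ny0 : 0 < `|y| by rewrite normr_gt0.
pose S : set R := [set s | 1 <= s /\ filled_julia p (x +i* (s * y))].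
have S1 : S 1 by split => //; rewrite mul1r.
have supS : has_sup S.
  split; first by exists 1.
  exists (rho / `|y|) => s [s1 sJ]; rewrite ler_pdivlMr //.
  apply: ltW; apply: le_lt_trans (filled_julia_lt rho_gt0 escape sJ).
  rewrite /= -{1}(ger0_norm (le_trans ler01 s1)) -normrM -sqrtr_sqr.
  by rewrite ler_wsqrtr // lerDr sqr_ge0.
have le_sup s : S s -> s <= sup S.
  by move=> Ss; apply: ub_le_sup => //; exact: supS.2.
have sup1 : 1 <= sup S by exact: le_sup.
have supF : fatou_set p (Some (x +i* (sup S * y))).
  apply: contrapT => /Jreal[r _ [_ /esym/eqP]].
  by rewrite mulf_eq0 (negPf y0) orbF gt_eqF // (lt_le_trans ltr01).
have [d d0 dJ] := fatou_filled_julia_locally_constant supF.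
pose e := d / `|y|; have e0 : 0 < e by rewrite divr_gt0.
have near_sup s : `|s - sup S| < e ->
    (filled_julia p (x +i* (s * y)) <-> filled_julia p (x +i* (sup S * y))).
  by move=> se; apply: dJ; rewrite normy -ltr_pdivlMr.
have [s [s1 sJ] ss] := sup_adherent e0 supS.
have supJ : filled_julia p (x +i* (sup S * y)).
  apply/(near_sup s) => //; have := le_sup s (conj s1 sJ).
  by move=> sle; rewrite ltr_norml; apply/andP; split; lra.
suff : S (sup S + e / 2).
  by move=> /le_sup; rewrite gerDl leNgt divr_gt0.
split; first by rewrite (le_trans sup1) // lerDl divr_ge0 // ltW.
apply/near_sup => //; rewrite addrAC subrr add0r gtr0_norm ?divr_gt0 //.
by rewrite ltr_pdivrMr // ltr_pMr // ltr1n.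
Qed.

(** The basin lies in the Fatou set, so the Julia set lies in the filled Julia set. *)
Lemma julia_real_of_filled_julia :
  filled_julia p `<=` range (fun x : R => x%:C) ->
  julia p `<=` range (fun x : R => Some x%:C).
Proof.
move=> Jreal x /(contra_not (@basin_fatou x)) /contrapT[z /Jreal[r _ <-] <-].
by exists r.
Qed.

End FatouSet.

(** * Consequences of all complex preperiodic points being real *)

Section PreperReal.
Variables (R : realType) (f : {poly R}).
Hypothesis size_f : (2 < size f)%N.
Let F := complex_poly f.
Hypothesis preper_real : preper (horner F) `<=` range (fun x : R => x%:C).

(** A complex fixed point exists, and by hypothesis it is real. *)
Lemma preper_nonempty : preper (horner f) !=set0.
Proof.
have sizeE : size (F - 'X) = size f.
  by rewrite size_polyDl size_map_poly // size_polyN size_polyX.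
have [z] : exists z, root (F - 'X) z.
  by apply/closed_rootP; rewrite sizeE; apply: contraTneq size_f => ->.
rewrite /root !hornerE subr_eq0 => /eqP Fz.
have pz : preper (horner F) z by exact: fixed_preper.
have [x _ /= xz] := preper_real pz.
by exists x; apply/preper_complex_poly; rewrite xz.
Qed.

(** Complex preimages of a preperiodic point are preperiodic, hence real. *)
Lemma preper_critical_interval : preper (horner f) `<=` critical_interval f.
Proof.
move=> t pt; apply: critical_interval_real_roots => [|z]; first exact: ltnW.
rewrite /complex_poly rmorphB /= map_polyC /root !hornerE subr_eq0 => /eqP zt.
apply: preper_real; apply/preper_stepE; rewrite -/F zt.
exact/preper_complex_poly.
Qed.

End PreperReal.

Theorem theorem4p1 (R : realType) (d : nat) (f : {poly R})
    (hd : (2 <= d)%N) (hf : size f = d.+1) :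
  [<-> julia (complex_poly f) `<=` range (fun x : R => Some x%:C);
       filled_julia (complex_poly f) `<=` range (fun x : R => x%:C);
       preper (horner (complex_poly f)) `<=` range (fun x : R => x%:C);
       preper (horner f) !=set0 /\ preper (horner f) `<=` critical_interval f].
Proof.
have size_f : (2 < size f)%N by rewrite hf ltnS.
have size_F : (2 < size (complex_poly f))%N by rewrite size_map_poly.
have [rho rho_gt0 escape] := horner_double size_F.
tfae.
- exact: (filled_julia_real_of_julia rho_gt0 escape).
- by move=> FJ_real z /preper_filled_julia /FJ_real.
- by split; [exact: preper_nonempty|exact: preper_critical_interval].
(* The cycle closes by way of the filled Julia set, shown to be real first. *)
- move=> [preper0 preper_crit].
  apply: (julia_real_of_filled_julia rho_gt0 escape).
  exact: (filled_julia_real size_f preper_crit rho_gt0 escape).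
Qed.
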